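(* Let $n\geq 2$ be an integer and $\mathbb{K}$ a field of characteristic $0$ or $\geq 2n+1$. Suppose that $\mathbb{K}$ is $2(n-1)!!$-radically closed. Let $G = \operatorname{SL}_2(\mathbb{K})$ and let $V$ be a $G$-module (i.e. a $\mathbb{Z}[G]$-module). Let $\mathbb{K}_1$ be the prime subfield of $\mathbb{K}$ and $G_1 = \operatorname{SL}_2(\mathbb{K}_1)$. Suppose that $V$ is a $\mathbb{K}_1$-vector space such that $V \simeq \bigoplus_I \operatorname{Sym}^{n-1} \operatorname{Nat} G_1$ as $\mathbb{K}_1[G_1]$-modules, for some index set $I$. Then $V$ bears a compatible $\mathbb{K}$-vector space structure for which $V \simeq\bigoplus_J \operatorname{Sym}^{n-1}\operatorname{Nat} G$ as $\mathbb{K}[G]$-modules, for some index set $J$.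
   Context: $G=\operatorname{SL}_2(\mathbb{K})$ is regarded as an abstract group. The double factorial is $m!! = m(m-2)(m-4)\cdots$ (product of the positive integers of the same parity as $m$ up to $m$). A field $\mathbb{K}$ is $k$-radically closed if for every $\alpha$ in an algebraic closure $\overline{\mathbb{K}}$, $\alpha^k\in\mathbb{K}$ implies $\alpha\in\mathbb{K}$. $\operatorname{Nat} \operatorname{SL}_2(F)$ is $F^2$ with the natural action and $\operatorname{Sym}^{n-1}\operatorname{Nat}\operatorname{SL}_2(F)$ is its $(n-1)$-th symmetric power over $F$, i.e. homogeneous polynomials of degree $n-1$ in two variables over $F$ with the substitution action. $\bigoplus_I M$ denotes a direct sum of copies of $M$ indexed by $I$. *)

(* Defs.v *)
From HB Require Import structures.
From mathcomp Require Import all_boot all_order all_algebra.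
From mathcomp.multinomials Require Import mpoly.
From Stdlib Require Lists.List.
Set Implicit Arguments. Unset Strict Implicit. Unset Printing Implicit Defensive.
Import GRing.Theory.
Local Open Scope ring_scope.

Fixpoint dfact (m : nat) : nat :=
  match m with
  | 0 => 1
  | 1 => 1
  | (m'.+2) as m0 => (m0 * dfact m')%N
  end.

(* K is k-radically closed: for every a in K, every root (in an algebraic
   closure) of X^k - a lies in K, i.e. X^k - a splits into linear factors
   over K. *)
Definition radically_closed (K : fieldType) (k : nat) : Prop :=
  forall a : K, exists s : seq K, 'X^k - a%:P = \prod_(x <- s) ('X - x%:P).

Definition in_prime_subfield (K : fieldType) (x : K) : Prop :=
  exists a b : int, (b%:~R : K) != 0 /\ x = a%:~R / b%:~R.

Definition SL2 (K : fieldType) (P : K -> Prop) (g : 'M[K]_2) : Prop :=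
  \det g = 1 /\ forall i j, P (g i j).

Definition is_SL2_module (K : fieldType) (V : zmodType)
    (act : 'M[K]_2 -> V -> V) : Prop :=
  [/\ forall g u v, SL2 (fun _ => True) g -> act g (u + v) = act g u + act g v,
      forall v, act 1%:M v = v &
      forall g h v, SL2 (fun _ => True) g -> SL2 (fun _ => True) h ->
        act (g *m h) v = act g (act h v)].

Definition is_vspace_over (K : fieldType) (P : K -> Prop) (V : zmodType)
    (scal : K -> V -> V) : Prop :=
  [/\ forall a u v, P a -> scal a (u + v) = scal a u + scal a v,
      forall a b v, P a -> P b -> scal (a + b) v = scal a v + scal b v,
      forall a b v, P a -> P b -> scal (a * b) v = scal a (scal b v) &
      forall v, scal 1 v = v].

(* substitution action of g on polynomials in two variables X_0, X_1:
   (g.p)(x, y) = p((x, y) g) *)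
Definition sym_act (K : fieldType) (g : 'M[K]_2) (p : {mpoly K[2]}) :
    {mpoly K[2]} :=
  p \mPo [tuple g 0 0 *: 'X_0 + g 1 0 *: 'X_1; g 0 1 *: 'X_0 + g 1 1 *: 'X_1].

(* f is an element of (+)_I Sym^{n-1} Nat SL_2(F), where F is the subfield P:
   a finitely supported family of homogeneous polynomials of degree n-1
   in two variables with coefficients in F *)
Definition in_dsum_Sym (K : fieldType) (P : K -> Prop) (n : nat) (I : Type)
    (f : I -> {mpoly K[2]}) : Prop :=
  (exists s : seq I, forall i, ~ Stdlib.Lists.List.In i s -> f i = 0) /\
  (forall i, f i \is (n.-1).-homog /\ forall m, P (f i)@_m).

Definition iso_dsum_Sym (K : fieldType) (P : K -> Prop) (n : nat)
    (V : zmodType) (act : 'M[K]_2 -> V -> V) (scal : K -> V -> V) : Prop :=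
  exists (I : Type) (phi : V -> I -> {mpoly K[2]}),
    [/\ forall u v i, phi (u + v) i = phi u i + phi v i,
        forall a v i, P a -> phi (scal a v) i = a *: phi v i,
        forall g v i, SL2 P g -> phi (act g v) i = sym_act g (phi v i),
        injective phi &
        (forall v, in_dsum_Sym P n (phi v)) /\
        (forall f, in_dsum_Sym P n f -> exists v, phi v = f)].

(* Main.v *)
Require Import Defs.
From HB Require Import structures.
From mathcomp Require Import all_boot all_order all_algebra.
From mathcomp.multinomials Require Import mpoly.
From mathcomp Require boolp classical_sets.
From mathcomp Require Import zify ring.
Set Implicit Arguments. Unset Strict Implicit. Unset Printing Implicit Defensive.
Import GRing.Theory.
Local Open Scope ring_scope.

(** Let N = n - 1 and let the E_jk be the matrix units of End(V) attached to the
    monomial coordinates of V. Then End(V) = M_n(C) with C the centralizer of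
    the E_jk, so each g in G becomes a matrix over C. The torus commutes with
    its prime-field points, whose weights are pairwise distinct, hence it is
    diagonal. Square roots make every u_b a torus conjugate of u_1, so the
    (j, k) entry of u_b is C(k, j) times a product of k - j "weight steps", and
    comparing entries in u_b u_1 = u_1 u_b shows all the steps to be equal to
    one alpha(b). Thus u_b = Sym^N of the unipotent with parameter alpha(b),
    with alpha additive. The relation
    t_a w = u_a (w u_{1/a} w^-1) u_a gives the lowest weight alpha(1/a)^N of
    t_a, whence t_a u_b = u_{a^2 b} t_a yields alpha(a^2 b) = alpha(a^2)
    alpha(b): alpha is a ring morphism K -> C. It is the required K-structure,
    and a K-basis of E_00 V gives the decomposition. *)

(** * Torus and unipotent matrices over a noncommutative ring *)

Section Core.
Context (K : fieldType) (R : pzRingType) (N : nat).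
(** Matrices here have size n = N + 2, so the exponent n - 1 is N + 1. The bound 2N + 3 is less than
    2n + 1, hence less than any positive characteristic. *)
Context (small_neq0 : forall m, (0 < m <= N.+1.*2.+1)%N -> m%:R != 0 :> K).
Context (tors : forall m (r : R), m%:R != 0 :> K -> r *+ m = 0 -> r = 0).
Context (sqK : forall a : K, exists b, b * b = a).

Lemma natr_inj_small p q : (p <= q <= N.+1.*2.+1)%N -> p%:R = q%:R :> K -> p = q.
Proof.
case/andP=> pq qN e; apply/eqP; rewrite eqn_leq pq /= leqNgt; apply/negP=> lt.
have := small_neq0 (m := q - p); rewrite natrB // e subrr eqxx.
by move=> H; suff: false by []; apply: H; lia.
Qed.

(** The residues of 1, ..., 2N + 3 are distinct in K, too many to be all roots of X^(2(k - j)) - 1,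
    whose degree is at most 2N + 2. *)
Lemma separating_nat j k : (j < k <= N.+1)%N ->
  exists2 a : nat, a%:R != 0 :> K & (a ^ (2 * (k - j)))%:R != 1 :> K.
Proof.
case/andP=> jk kN.
pose rs := [seq i%:R | i <- iota 1 N.+1.*2.+1] : seq K.
case: (boolP (all (2 * (k - j)).-unity_root rs)) => [al|].
  have := max_unity_roots _ al; rewrite size_map size_iota.
  have -> : uniq rs.
    rewrite map_inj_in_uniq ?iota_uniq // => p q; rewrite !mem_iota => hp hq e.
    case: (leqP p q) => [pq|/ltnW pq]; first by apply: natr_inj_small => //; lia.
    by apply/esym/natr_inj_small => //; lia.
  by move=> /(_ _ isT); lia.
case/allPn=> x /mapP [a]; rewrite mem_iota => ha -> hn.
exists a; first by apply: small_neq0; lia.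
by move: hn; rewrite unity_rootE natrX.
Qed.

Lemma mulrn_inj p q (r : R) : p%:R != q%:R :> K -> r *+ p = r *+ q -> r = 0.
Proof.
wlog pq : p q / (p <= q)%N.
  move=> H ne e; case: (leqP p q) => [|/ltnW] h; first exact: (H p q).
  by apply: (H q p) => //; rewrite eq_sym.
move=> ne e; apply: (@tors (q - p)); first by rewrite natrB // subr_eq0 eq_sym.
by rewrite mulrnBr // e subrr.
Qed.

(* [tw] is the relation t_a w = u_a (w u_{1/a} w^-1) u_a, freed of inverses. *)
Context (u t : K -> 'M[R]_N.+2) (w : 'M[R]_N.+2).
Context (u0 : u 0 = 1%:M).
Context (uD : forall a b, u (a + b) = u a *m u b).
Context (tM : forall a b : K, a != 0 -> b != 0 -> t (a * b) = t a *m t b).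
Context (t1 : t 1 = 1%:M).
Context (tu : forall a b : K, a != 0 -> t a *m u b = u (a * a * b) *m t a).
Context (tw : forall a : K, a != 0 ->
  t a *m (w *m (u (- a) *m w)) = u a *m (w *m u a^-1)).
Context (u1 : forall j k, u 1 j k = 'C(k, j)%:R).
Context (wE : forall j k : 'I_N.+2,
  w j k = if (j + k == N.+1)%N then (-1) ^+ j else 0).
(** The weight a^(N + 1 - 2k) of t_a, multiplied by a^(N + 1) so that only natural multiples occur:
    R is not given as a K-algebra. *)
Context (tE : forall (a : nat) j k, a%:R != 0 :> K ->
  t a%:R j k *+ a ^ N.+1 = (a ^ (2 * (N.+1 - k)))%:R *+ (j == k)).

(** Compare the (j, k) entries of t_a t_b = t_b t_a for a natural number b: two weights of t_b
    multiply the entry of t_a to the same value. A b separating these weights kills the entry. *)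
Lemma t_diag (a : K) j k : a != 0 -> j != k -> t a j k = 0.
Proof.
move=> a0 njk.
suff [b b0 hb]: exists2 b : nat, b%:R != 0 :> K &
    (b ^ (2 * (N.+1 - k)))%:R != (b ^ (2 * (N.+1 - j)))%:R :> K.
  apply: (mulrn_inj hb).
  have e : (t a *m t b%:R) j k *+ b ^ N.+1 = (t b%:R *m t a) j k *+ b ^ N.+1.
    by rewrite -!tM // mulrC.
  move: e; rewrite !mxE -!sumrMnl.
  rewrite (bigD1 k) //= -mulrnAr tE // eqxx big1 => [|i nik]; last first.
    by rewrite -mulrnAr tE // (negPf nik) mulr0.
  rewrite (bigD1 j) //= -mulrnAl tE // eqxx big1 => [|i nij]; last first.
    by rewrite -mulrnAl tE // eq_sym (negPf nij) mul0r.
  by rewrite !addr0 mulr1n mulr_natr mulr_natl.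
have key p q : (p < q <= N.+1)%N -> exists2 b : nat, b%:R != 0 :> K &
    (b ^ (2 * (N.+1 - p)))%:R != (b ^ (2 * (N.+1 - q)))%:R :> K.
  move=> pq; have [b b0 hb] := separating_nat pq; exists b => //.
  rewrite (_ : 2 * (N.+1 - p) = 2 * (q - p) + 2 * (N.+1 - q))%N; last by lia.
  rewrite expnD natrM -[X in _ != X]mul1r (inj_eq (mulIf _)) //.
  by rewrite natrX expf_neq0.
have := ltn_ord j; have := ltn_ord k; move: njk; rewrite -val_eqE /= neq_ltn =>
  /orP [] h hk hj.
  by have [|b b0 hb] := key j k; [lia|exists b; rewrite // eq_sym].
by have [|b b0 hb] := key k j; [lia|exists b].
Qed.

Lemma mul_tmx (a : K) (X : 'M[R]_N.+2) j k : a != 0 ->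
  (t a *m X) j k = t a j j * X j k.
Proof.
move=> a0; rewrite mxE (bigD1 j) //= big1 ?addr0 // => i nij.
by rewrite t_diag ?mul0r // eq_sym.
Qed.

Lemma mul_mxt (a : K) (X : 'M[R]_N.+2) j k : a != 0 ->
  (X *m t a) j k = X j k * t a k k.
Proof.
move=> a0; rewrite mxE (bigD1 k) //= big1 ?addr0 // => i nij.
by rewrite t_diag ?mulr0.
Qed.

Lemma t_diagV (a : K) k : a != 0 -> t a k k * t a^-1 k k = 1.
Proof.
by move=> a0; rewrite -mul_tmx // -tM ?invr_neq0 // divff // t1 !mxE eqxx.
Qed.

(** Entry (j, k) of t_a u_1 = u_{a^2} t_a, with the k-th weight moved across by its inverse; u_1
    contributes the binomial. *)
Lemma u_sqr (a : K) j k : a != 0 ->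
  u (a * a) j k = (t a j j * t a^-1 k k) *+ 'C(k, j).
Proof.
move=> a0; have := congr1 (fun X : 'M_N.+2 => X j k) (tu 1 a0).
rewrite /= mul_tmx // mul_mxt // mulr1 u1 => /(congr1 (fun x => x * t a^-1 k k)).
by rewrite -!mulrA t_diagV // mulr1 => <-; rewrite mulrA mulr_natr mulrnAl.
Qed.

(** A nonzero b is a square, so [u_sqr] applies: on the diagonal the two weights cancel, and below
    it the binomial vanishes. *)
Lemma u_triang b (j k : 'I_N.+2) : (k <= j)%N -> u b j k = (j == k)%:R.
Proof.
move=> kj; have [->|b0] := eqVneq b 0; first by rewrite u0 mxE.
have [a ab] := sqK b; have a0 : a != 0 by apply: contraNneq b0 => a0;
  rewrite -ab a0 mul0r.
rewrite -ab u_sqr //; have [<-|njk] := eqVneq j k; first by rewrite t_diagV // binn.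
by rewrite bin_small // ltn_neqAle kj eq_sym andbT.
Qed.

Lemma u_diag b j : u b j j = 1.
Proof. by rewrite u_triang ?eqxx. Qed.

(** Only indices between row and column survive in a product of upper triangular matrices. The first
    superdiagonal gives additivity of [alpha], the second one the commutation identities. *)
Lemma mulmx_triang2 (X Y : 'M[R]_N.+2) (i0 i1 : 'I_N.+2) :
  i1 = i0.+1 :> nat ->
  (forall j k : 'I_N.+2, (k < j)%N -> X j k = 0) ->
  (forall j k : 'I_N.+2, (k < j)%N -> Y j k = 0) ->
  (X *m Y) i0 i1 = X i0 i0 * Y i0 i1 + X i0 i1 * Y i1 i1.
Proof.
move=> e1 hX hY; rewrite mxE (bigD1 i0) //= (bigD1 i1) /=; last first.
  by rewrite -val_eqE /= e1; lia.
rewrite big1 ?addr0 // => i /andP [].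
rewrite -!val_eqE /= e1 => n0 n1; case: (ltnP i i0) => h;
  first by rewrite hX ?mul0r.
by rewrite hY ?mulr0 // e1; lia.
Qed.

Lemma mulmx_triang3 (X Y : 'M[R]_N.+2) (i0 i1 i2 : 'I_N.+2) :
  i1 = i0.+1 :> nat -> i2 = i0.+2 :> nat ->
  (forall j k : 'I_N.+2, (k < j)%N -> X j k = 0) ->
  (forall j k : 'I_N.+2, (k < j)%N -> Y j k = 0) ->
  (X *m Y) i0 i2 = X i0 i0 * Y i0 i2 + X i0 i1 * Y i1 i2 + X i0 i2 * Y i2 i2.
Proof.
move=> e1 e2 hX hY; rewrite mxE (bigD1 i0) //= (bigD1 i1) /=; last first.
  by rewrite -val_eqE /= e1; lia.
rewrite (bigD1 i2) /=; last by rewrite -!val_eqE /= e1 e2; lia.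
rewrite big1 ?addr0 ?addrA // => i /andP [/andP []].
rewrite -!val_eqE /= e1 e2 => n0 n1 n2.
case: (ltnP i i0) => h; first by rewrite hX ?mul0r.
by rewrite hY ?mulr0 // e2; lia.
Qed.

Lemma u_triang0 b (j k : 'I_N.+2) : (k < j)%N -> u b j k = 0.
Proof. by move=> kj; rewrite u_triang ?(ltnW kj) // -val_eqE /= gtn_eqF. Qed.

Lemma mulrn_inj_small p q (r s : R) : (0 < p <= N.+2)%N -> (0 < q <= N.+2)%N ->
  r *+ p *+ q = s *+ p *+ q -> r = s.
Proof.
move=> hp hq /eqP; rewrite -!mulrnA -subr_eq0 -mulrnBl => /eqP e.
apply/eqP; rewrite -subr_eq0; apply/eqP/tors/e.
by rewrite natrM mulf_neq0 // small_neq0 //; lia.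
Qed.

Definition alpha b := u b 0 1.


(** Induction on i: in u_{a^2} u_1 = u_1 u_{a^2} the (i, i + 2) entries say that the steps at i and
    i + 1 agree after multiplication by (i + 1)(i + 2), which can be cancelled. *)
Lemma weight_step (a : K) (i : nat) : a != 0 -> (i <= N)%N ->
  t a (inord i) (inord i) * t a^-1 (inord i.+1) (inord i.+1) = alpha (a * a).
Proof.
move=> a0; elim: i => [|i IH] iN.
  have e0 : inord 0 = 0 :> 'I_N.+2 by apply: val_inj; rewrite /= inordK.
  have e1 : inord 1 = 1 :> 'I_N.+2 by apply: val_inj; rewrite /= inordK.
  by rewrite /alpha u_sqr // bin0 mulr1n e0 e1.
rewrite -IH ?(ltnW iN) //.
set i0 : 'I_N.+2 := inord i; set i1 : 'I_N.+2 := inord i.+1.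
set i2 : 'I_N.+2 := inord i.+2.
have v0 : i0 = i :> nat by rewrite inordK //; lia.
have v1 : i1 = i.+1 :> nat by rewrite inordK //; lia.
have v2 : i2 = i.+2 :> nat by rewrite inordK //; lia.
have e1 : i1 = i0.+1 :> nat by rewrite v0.
have e2 : i2 = i0.+2 :> nat by rewrite v0.
(* The commutation is read off from the two expansions of u_{a^2 + 1}. *)
have := congr1 (fun X : 'M_N.+2 => X i0 i2) (uD (a * a) 1).
rewrite [X in u X]addrC uD /=.
do 2![rewrite (mulmx_triang3 e1 e2); try exact: u_triang0].
rewrite !u_diag !mul1r !mulr1 addrAC [RHS]addrAC.
rewrite [u 1 i0 i2 + _]addrC => /addrI.
rewrite !u1 !u_sqr // v0 v1 v2 !binSn mulr_natr mulr_natl.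
rewrite [_ *+ i.+2 *+ i.+1]mulrnAC; apply: mulrn_inj_small; lia.
Qed.

(** The product of d successive steps telescopes, since t_a and t_{1/a} have inverse weights. *)
Lemma weight_diff (a : K) (i d : nat) : a != 0 -> (i + d <= N.+1)%N ->
  t a (inord i) (inord i) * t a^-1 (inord (i + d)) (inord (i + d)) =
  alpha (a * a) ^+ d.
Proof.
move=> a0; elim: d => [|d IH] h; first by rewrite addn0 t_diagV ?expr0.
rewrite exprSr -IH; last by lia.
rewrite -(@weight_step a (i + d)) //; last by lia.
rewrite -!mulrA; congr (_ * _); rewrite mulrA.
have := @t_diagV a^-1 (inord (i + d)); rewrite invrK invr_neq0 // => -> //.
by rewrite mul1r addnS.
Qed.

Lemma alpha1 : alpha 1 = 1.
Proof. by rewrite /alpha u1 bin0. Qed.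

Lemma alphaD a b : alpha (a + b) = alpha a + alpha b.
Proof.
rewrite /alpha uD mulmx_triang2 //; try exact: u_triang0.
by rewrite !u_diag mul1r mulr1 addrC.
Qed.

Lemma alpha0 : alpha 0 = 0.
Proof. by apply: (addrI (alpha 0)); rewrite -alphaD !addr0. Qed.

(** Above the diagonal and for b = a^2 nonzero, [u_sqr] gives a ratio of weights, which
    [weight_diff] turns into a power of [alpha]. *)
Lemma u_alpha b j k : u b j k = alpha b ^+ (k - j) *+ 'C(k, j).
Proof.
case: (leqP k j) => [kj|jk].
  rewrite u_triang // (eqP kj) expr0; have [->|njk] := eqVneq j k;
    first by rewrite binn.
  by rewrite bin_small // ltn_neqAle kj eq_sym andbT.
have [->|b0] := eqVneq b 0.
  rewrite u0 mxE alpha0 expr0n -(inj_eq val_inj) ltn_eqF //= subn_eq0 leqNgt jk.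
  by rewrite mul0rn.
have [a ab] := sqK b; have a0 : a != 0 by apply: contraNneq b0 => a0;
  rewrite -ab a0 mul0r.
rewrite -ab u_sqr // -(@weight_diff a j) //;
  last by rewrite subnKC ?(ltnW jk) // -ltnS.
by rewrite subnKC ?(ltnW jk) // !inord_val.
Qed.

(** The (0, 2) entries of u_a u_b = u_b u_a give the identity up to a factor 2. They exist only when
    N > 0. *)
Lemma alphaC a b : (0 < N)%N -> alpha a * alpha b = alpha b * alpha a.
Proof.
move=> N0; have l2 : (2 < N.+2)%N by lia.
have e2 : Ordinal l2 = (nat_of_ord (0%R : 'I_N.+2)).+2 :> nat by [].
have e1 : (1%R : 'I_N.+2) = (nat_of_ord (0%R : 'I_N.+2)).+1 :> nat by [].
have := congr1 (fun X : 'M_N.+2 => X 0 (Ordinal l2)) (uD a b).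
rewrite [X in u X]addrC uD /=.
do 2![rewrite (mulmx_triang3 e1 e2); try exact: u_triang0].
rewrite !u_diag !mul1r !mulr1 addrAC [RHS]addrAC.
rewrite [u b _ _ + _]addrC => /addrI.
rewrite !u_alpha /= !bin0 !bin1 subn0 (_ :
  2 - 1 = 1)%N // !expr1 !mulr1n !mulrnAr => e.
apply/esym/(@mulrn_inj_small 1 2) => //; lia.
Qed.

(** Compare the lower right entries in [tw]: multiplying by w on the left makes row 0, up to the
    sign (-1)^(N + 1), the last row, and the upper right entry of u_{1/a} is alpha(1/a)^(N + 1). The
    signs cancel. *)
Lemma t_last (a : K) : a != 0 -> t a ord_max ord_max = alpha a^-1 ^+ N.+1.
Proof.
move=> a0; have := congr1 (fun X : 'M_N.+2 => X ord_max ord_max) (tw a0).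
have wl (X : 'M[R]_N.+2) k : (w *m X) ord_max k = (-1) ^+ N.+1 * X 0 k.
  rewrite mxE (bigD1 0) //= big1 ?addr0 => [|i i0].
    by rewrite wE /= addn0 eqxx.
  by rewrite wE ifN ?mul0r //=; move: i0; rewrite -val_eqE /=; lia.
have wr (X : 'M[R]_N.+2) k : (X *m w) k ord_max = X k 0.
  rewrite mxE (bigD1 0) //= big1 ?addr0 => [|i i0].
    by rewrite wE /= add0n eqxx mulr1.
  by rewrite wE ifN ?mulr0 //=; move: i0; rewrite -val_eqE /=; lia.
rewrite /= mul_tmx // wl wr u_diag mulr1.
rewrite mxE (bigD1 ord_max) //= big1 ?addr0 => [|i ni]; last first.
  by rewrite u_triang0 ?mul0r //=; move: ni (ltn_ord i); rewrite -val_eqE /=; lia.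
rewrite u_diag mul1r wl u_alpha /= bin0 subn0 mulr1n -signr_odd.
by case: odd; rewrite ?expr0 ?expr1 ?mulr1 ?mul1r // mulrN1 mulN1r => /oppr_inj.
Qed.

Lemma alphaM (a b : K) : alpha (a * b) = alpha a * alpha b.
Proof.
have [->|a0] := eqVneq a 0; first by rewrite mul0r alpha0 mul0r.
have [->|b0] := eqVneq b 0; first by rewrite mulr0 alpha0 mulr0.
(* For 2 x 2 matrices there is no (0, 2) entry to give commutation; instead [alpha] is itself a
   weight of the torus, hence multiplicative. *)
have [N0|N0] := posnP N.
  have h c : c != 0 -> alpha c = t c^-1 ord_max ord_max.
    by move=> c0; rewrite t_last ?invr_neq0 // invrK N0 expr1.
  by rewrite !h ?mulf_neq0 // invfM tM ?invr_neq0 // mul_tmx ?invr_neq0.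
have [c ca] := sqK a; have c0 : c != 0 by apply: contraNneq a0 => c0;
  rewrite -ca c0 mul0r.
pose i : 'I_N.+2 := inord N; have vi : i = N :> nat by rewrite inordK.
(* Entry (N, N + 1) of t_c u_x = u_{c^2 x} t_c, with the factor N + 1 cancelled. Taking x = 1 and x
   = b eliminates the weight at N; the last weight, a power of [alpha], is then moved past alpha(b)
   and cancelled. *)
have key x : t c i i * alpha x = alpha (c * c * x) * t c ord_max ord_max.
  have := congr1 (fun X : 'M_N.+2 => X i ord_max) (tu x c0).
  rewrite /= mul_tmx // mul_mxt // !u_alpha vi /= subSn // subnn binSn expr1.
  rewrite mulrnAr mulrnAl => e; apply: (@mulrn_inj_small N.+1 1) => //; lia.
have := key b; have := key 1; rewrite alpha1 !mulr1 ca => ->.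
have com : t c ord_max ord_max * alpha b = alpha b * t c ord_max ord_max.
  by rewrite t_last //; apply/esym/commrX; apply: alphaC.
rewrite -mulrA com mulrA => /(congr1 (fun x => x * t c^-1 ord_max ord_max)).
by rewrite -!mulrA t_diagV // !mulr1.
Qed.

Lemma unipotent_morphism : [/\ alpha 1 = 1,
  (forall a b, alpha (a + b) = alpha a + alpha b),
  (forall a b, alpha (a * b) = alpha a * alpha b) &
  (forall b j k, u b j k = alpha b ^+ (k - j) *+ 'C(k, j))].
Proof. by split; [exact: alpha1|exact: alphaD|exact: alphaM|exact: u_alpha]. Qed.
End Core.

(** * Generators of SL_2 *)

Lemma lift01 : lift ord0 ord0 = 1 :> 'I_2.
Proof. exact: val_inj. Qed.

Section SL2.
Context (K : fieldType).

Definition mx2 (a b c d : K) : 'M[K]_2 :=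
  \matrix_(i, j) if i == 0 then if j == 0 then a else b
                 else if j == 0 then c else d.

Lemma mx2_eta (g : 'M[K]_2) : g = mx2 (g 0 0) (g 0 1) (g 1 0) (g 1 1).
Proof.
apply/matrixP => i j; rewrite mxE.
by case: i j => [[|[|i]] hi] [[|[|j]] hj] //=; congr (g _ _); apply: val_inj.
Qed.

Lemma mulmx2 a b c d a' b' c' d' : mx2 a b c d *m mx2 a' b' c' d' =
  mx2 (a * a' + b * c') (a * b' + b * d') (c * a' + d * c') (c * b' + d * d').
Proof.
apply/matrixP => i j; rewrite !mxE !big_ord_recl big_ord0 !mxE /= addr0.
by case: ifP => _; case: ifP.
Qed.

Lemma mx2_1 : mx2 1 0 0 1 = 1%:M.
Proof. by apply/matrixP => [[[|[|i]] hi] [[|[|j]] hj]]; rewrite !mxE. Qed.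

Lemma det_mx2 a b c d : \det (mx2 a b c d) = a * d - b * c.
Proof.
rewrite (expand_det_row _ 0) !big_ord_recl big_ord0 /cofactor !det_mx11 !mxE /=.
by rewrite expr0 expr1 addr0 mul1r mulN1r mulrN.
Qed.

Definition umx (b : K) := mx2 1 b 0 1.
Definition tmx (a : K) := mx2 a 0 0 a^-1.
Definition wmx := mx2 0 1 (-1) 0.

Lemma det_umx b : \det (umx b) = 1. Proof. by rewrite det_mx2; ring. Qed.
Lemma det_wmx : \det wmx = 1. Proof. by rewrite det_mx2; ring. Qed.
Lemma det_tmx a : a != 0 -> \det (tmx a) = 1.
Proof. by move=> a0; rewrite det_mx2 divff // mulr0 subr0. Qed.

(** If c is nonzero, g is a product of an upper, a lower and an upper unipotent, the lower one being
    the conjugate of u_{-c} by w. As P is only closed under products, w^-1 is written w^3. *)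
Lemma SL2_gen (P : 'M[K]_2 -> Prop) :
  (forall g h, \det g = 1 -> \det h = 1 -> P g -> P h -> P (g *m h)) ->
  (forall b, P (umx b)) -> P wmx -> forall g, \det g = 1 -> P g.
Proof.
move=> PM Pu Pw.
have PM' g h : \det g = 1 /\ P g -> \det h = 1 /\ P h ->
    \det (g *m h) = 1 /\ P (g *m h).
  by move=> [g1 Pg] [h1 Ph]; split; [rewrite det_mulmx g1 h1 mulr1|apply: PM].
have Pu' b : \det (umx b) = 1 /\ P (umx b) by split; rewrite ?det_umx.
have Pw' : \det wmx = 1 /\ P wmx by split; rewrite ?det_wmx.
have big a b c d : c != 0 -> a * d - b * c = 1 -> P (mx2 a b c d).
  move=> c0 e.
  have -> : mx2 a b c d = umx ((a - 1) / c) *m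
      ((wmx *m (umx (- c) *m (wmx *m (wmx *m wmx)))) *m umx ((d - 1) / c)).
    rewrite !mulmx2; congr mx2; [by field| |by ring|by field].
    by apply: (mulIf c0); rewrite -[b * c](addrK 1) -[X in b * c + X]e; field.
  by case: (PM' _ _ (Pu' ((a - 1) / c)) (PM' _ _ (PM' _ _ Pw' (PM' _ _ (Pu' (- c))
    (PM' _ _ Pw' (PM' _ _ Pw' Pw')))) (Pu' ((d - 1) / c)))).
move=> g; rewrite [g]mx2_eta det_mx2.
move: (g 0 0) (g 0 1) (g 1 0) (g 1 1) => a b c d e.
have [c0|c0] := eqVneq c 0; last exact: big.
have a0 : a != 0.
  by apply/eqP => a0; move/eqP: e; rewrite a0 c0 mul0r mulr0 subr0 eq_sym oner_eq0.
(* Here c = 0: the matrix w g has the nonzero lower left entry -a, so the previous case applies to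
   it. *)
have -> : mx2 a b c d = (wmx *m (wmx *m wmx)) *m mx2 c d (- a) (- b).
  by rewrite !mulmx2; congr mx2; ring.
have w3 := PM' _ _ Pw' (PM' _ _ Pw' Pw').
apply: PM; [exact: w3.1| |exact: w3.2|apply: big]; rewrite ?oppr_eq0 //.
  by rewrite det_mx2 -e; ring.
by rewrite -e; ring.
Qed.

End SL2.

(** * Symmetric powers in the monomial basis *)

Section SymPow.
Context (K : fieldType).
Implicit Types (p q : {mpoly K[2]}) (g h : 'M[K]_2).

Lemma sym_act_mon g m : sym_act g 'X_[m] =
  (g 0 0 *: 'X_0 + g 1 0 *: 'X_1) ^+ m 0 *
  (g 0 1 *: 'X_0 + g 1 1 *: 'X_1) ^+ m 1.
Proof.
rewrite /sym_act comp_mpolyX !big_ord_recl big_ord0 mulr1 /=.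
by rewrite lift01 !(tnth_nth 0).
Qed.

Lemma sym_act_sum g (I : Type) (r : seq I) (P : pred I) (F : I -> {mpoly K[2]}) :
  sym_act g (\sum_(i <- r | P i) F i) = \sum_(i <- r | P i) sym_act g (F i).
Proof. by rewrite /sym_act raddf_sum. Qed.

Lemma sym_actZ g c p : sym_act g (c *: p) = c *: sym_act g p.
Proof. by rewrite /sym_act comp_mpolyZ. Qed.

(** By linearity and multiplicativity it suffices to compare the images of X_0 and X_1, which are
    given by the columns of the matrices. *)
Lemma sym_actM g h p : sym_act (g *m h) p = sym_act g (sym_act h p).
Proof.
rewrite [p]mpolyE sym_act_sum [sym_act h _]sym_act_sum sym_act_sum; apply:
  eq_bigr => m _.
rewrite !sym_actZ; congr (_ *: _); rewrite [sym_act h _]sym_act_mon sym_act_mon.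
rewrite /sym_act rmorphM !rmorphXn /= !raddfD /= !comp_mpolyZ !comp_mpolyXU /=.
rewrite !mxE !big_ord_recl !big_ord0 !addr0 /=.
rewrite lift01.
rewrite !scalerDr !scalerA !scalerDl.
by congr (_ ^+ _ * _ ^+ _); rewrite addrACA; congr (_ + _ + (_ + _));
   rewrite mulrC.
Qed.

(** Indexing by the exponent of X_1 puts the highest weight vector at index 0 and makes [umx b] act
    by an upper triangular matrix. *)
Definition mon (d k : nat) : 'X_{1..2} :=
  [multinom if val i == 0%N then (d - k)%N else k | i < 2].

Lemma mon0 d k : mon d k 0 = (d - k)%N. Proof. by rewrite mnmE. Qed.
Lemma mon1 d k : mon d k 1 = k. Proof. by rewrite mnmE. Qed.

Lemma mon_inj d j k : (mon d j == mon d k) = (j == k).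
Proof.
by apply/eqP/eqP => [/(congr1 (fun m : 'X_{1..2} => m 1))|->]; rewrite ?mon1.
Qed.

Lemma mdeg2 (m : 'X_{1..2}) : mdeg m = addn (m 0) (m 1).
Proof. by rewrite mdegE !big_ord_recl big_ord0 addn0 lift01. Qed.

Lemma mdeg_mon d (k : 'I_d.+1) : mdeg (mon d k) = d.
Proof. by rewrite mdeg2 mon0 mon1 subnK // -ltnS. Qed.

Lemma mon_mdeg m : m = mon (mdeg m) (m 1).
Proof.
apply/mnmP => i; rewrite mnmE mdeg2 addnK.
by case: i => [[|[|i]] hi] //=; congr (m _); apply: val_inj.
Qed.

Lemma coef_sum_mon d (c : 'I_d.+1 -> K) (j : 'I_d.+1) :
  (\sum_k c k *: 'X_[mon d k])@_(mon d j) = c j.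
Proof.
rewrite raddf_sum /= (bigD1 j) //= mcoeffZ mcoeffX eqxx mulr1 big1 ?addr0 //.
by move=> k njk; rewrite mcoeffZ mcoeffX mon_inj (inj_eq val_inj) (negPf njk) mulr0.
Qed.

Lemma coef_sum_mon_neq d (c : 'I_d.+1 -> K) m : mdeg m != d ->
  (\sum_k c k *: 'X_[mon d k])@_m = 0.
Proof.
move=> hm; rewrite raddf_sum /= big1 // => k _.
rewrite mcoeffZ mcoeffX (_ : (mon d k == m) = false) ?mulr0 //.
by apply/eqP => e; rewrite -e mdeg_mon eqxx in hm.
Qed.

Lemma sum_mon_homog d (c : 'I_d.+1 -> K) :
  \sum_k c k *: 'X_[mon d k] \is d.-homog.
Proof.
apply/dhomogP => m; rewrite mcoeff_msupp => hm; apply/eqP.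
by apply: contraNT hm => /coef_sum_mon_neq ->.
Qed.

Lemma homog_mon d p : p \is d.-homog ->
  p = \sum_(k < d.+1) p@_(mon d k) *: 'X_[mon d k].
Proof.
move=> hp; apply/mpolyP => m.
have [e|ne] := eqVneq (mdeg m) d; last first.
  by rewrite coef_sum_mon_neq // (dhomog_nemf_coeff hp ne).
have lt : leq (m 1).+1 d.+1.
  by rewrite ltnS -e mdeg2 leq_addl.
by rewrite [m]mon_mdeg e -[m 1]/(nat_of_ord (Ordinal lt)) coef_sum_mon.
Qed.

Lemma mpolyX_mon d k : 'X_[K, mon d k] = 'X_0 ^+ (d - k) * 'X_1 ^+ k.
Proof.
by rewrite mpolyXE_id !big_ord_recl big_ord0 mulr1 lift01 mon0 mon1.
Qed.

Lemma sym_act_umx d (b : K) (k : 'I_d.+1) : sym_act (umx b) 'X_[mon d k] =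
  \sum_(j < d.+1) (b ^+ (k - j) *+ 'C(k, j)) *: 'X_[mon d j].
Proof.
rewrite sym_act_mon !mxE /= mon0 mon1 scale1r scale0r addr0 scale1r.
rewrite exprDn big_distrr /=.
(* The binomial sum stops at j = k; it is widened to all j up to d, where the binomials vanish. *)
rewrite (big_ord_widen d.+1 (fun j => 'X_0 ^+ (d - k) *
  ((b *: 'X_0) ^+ (k - j) * 'X_1 ^+ j *+ 'C(k, j)))) /=; last exact: ltn_ord.
rewrite big_mkcond; apply: eq_bigr => j _; case: ltnP => kj; last first.
  by rewrite bin_small // mulr0n scale0r.
rewrite mpolyX_mon exprZn -scalerAl scalerMnl -scalerAr mulrA -exprD.
by congr (_ *: (_ ^+ _ * _)); have := ltn_ord k; lia.
Qed.

Lemma sym_act_wmx d (k : 'I_d.+1) : sym_act (wmx K) 'X_[mon d k] =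
  (-1) ^+ (d - k) *: 'X_[mon d (rev_ord k)].
Proof.
rewrite sym_act_mon !mxE /= mon0 mon1 !scale0r add0r addr0 scale1r.
rewrite mpolyX_mon /= subSS subKn; last by rewrite -ltnS.
by rewrite exprZn -scalerAl mulrC.
Qed.

Lemma sym_act_tmx d (a : K) (k : 'I_d.+1) : sym_act (tmx a) 'X_[mon d k] =
  (a ^+ (d - k) * a^-1 ^+ k) *: 'X_[mon d k].
Proof.
rewrite sym_act_mon !mxE /= mon0 mon1 !scale0r add0r addr0.
by rewrite !exprZn mpolyX_mon -scalerAl -scalerAr scalerA.
Qed.
End SymPow.

(** * Bases and coordinates of a subspace *)

Section Basis.
Context (K : fieldType) (L : lmodType K) (P : L -> Prop).
Context (P0 : P 0) (PD : forall u v, P u -> P v -> P (u + v)).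
Context (PZ : forall a v, P v -> P (a *: v)).

Definition independent (B : L -> Prop) := forall (s : seq L) (f : L -> K),
  uniq s -> (forall x, x \in s -> B x) ->
  \sum_(x <- s) f x *: x = 0 -> forall x, x \in s -> f x = 0.

(** Coefficients are functions on all of L, zero off a finite subset of B, so that coordinates of
    different vectors can be added pointwise. *)
Definition coords (B : L -> Prop) (v : L) (c : L -> K) := exists s : seq L,
  [/\ uniq s, (forall x, x \in s -> B x), (forall x, x \notin s -> c x = 0) &
      v = \sum_(x <- s) c x *: x].

Lemma sum_extend (s s' : seq L) (c : L -> K) : uniq s -> uniq s' ->
  {subset s <= s'} -> (forall x, x \notin s -> c x = 0) ->
  \sum_(x <- s') c x *: x = \sum_(x <- s) c x *: x.
Proof.
move=> us us' sub c0; rewrite (bigID (mem s)) /= [X in _ + X]big1 =>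
  [|x /c0 ->]; last exact: scale0r.
rewrite addr0 -big_filter; apply: perm_big; apply: uniq_perm => //.
  exact: filter_uniq.
by move=> x; rewrite mem_filter /=; case: (boolP (x \in s)) => //= /sub.
Qed.

Lemma coordsD B u v c d : coords B u c -> coords B v d ->
  coords B (u + v) (fun x => c x + d x).
Proof.
move=> [s [us sB c0 ->]] [t [ut tB d0 ->]]; exists (undup (s ++ t)).
split; rewrite ?undup_uniq //.
- by move=> x; rewrite mem_undup mem_cat => /orP [/sB|/tB].
- by move=> x; rewrite mem_undup mem_cat negb_or => /andP [/c0 -> /d0 ->];
  rewrite addr0.
- rewrite -(sum_extend us (undup_uniq (s ++ t)) _ c0) => [|x xs]; last first.
    by rewrite mem_undup mem_cat xs.
  rewrite -(sum_extend ut (undup_uniq (s ++ t)) _ d0) => [|x xs]; last first.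
    by rewrite mem_undup mem_cat xs orbT.
  by rewrite -big_split; apply: eq_bigr => x _; rewrite scalerDl.
Qed.

Lemma coordsZ B a v c : coords B v c -> coords B (a *: v) (fun x => a * c x).
Proof.
move=> [s [us sB c0 ->]]; exists s; split=> // [x /c0 ->|]; first by rewrite mulr0.
by rewrite scaler_sumr; apply: eq_bigr => x _; rewrite scalerA.
Qed.

Lemma coords_inj B v c d : independent B -> coords B v c -> coords B v d ->
  forall x, c x = d x.
Proof.
move=> iB cv /(coordsZ (-1)) dv x; have := coordsD cv dv.
rewrite scaleN1r subrr => -[s [us sB h0 /esym e]].
apply/eqP; rewrite -subr_eq0 -mulN1r; apply/eqP.
by case: (boolP (x \in s)) => [xs|/h0 //]; apply: (iB s _ us sB e).
Qed.

(** Zorn's lemma for the independent subsets of P. The union of a chain is independent because a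
    nonempty finite subset of it lies in one member. *)
Lemma maximal_independent : exists B : L -> Prop,
  [/\ forall x, B x -> P x, independent B &
      forall v, P v -> exists c, coords B v c].
Proof.
pose T := {B : L -> Prop | (forall x, B x -> P x) /\ independent B}.
pose le (B C : T) := boolp.asbool (forall x, sval B x -> sval C x).
have [||||[B [BP iB]] maxB] := @classical_sets.Zorn T le.
- by move=> B; apply/boolp.asboolP.
- move=> B C D /boolp.asboolP BC /boolp.asboolP CD.
  by apply/boolp.asboolP => x /BC /CD.
- move=> [B hB] [C hC] /boolp.asboolP /= BC /boolp.asboolP /= CB.
  have e : B = C by apply: boolp.funext => x; apply: boolp.propext; split;
    [apply: BC|apply: CB].
  by subst C; congr exist; apply: boolp.Prop_irrelevance.
- move=> A tot; pose U x := exists2 C, A C & sval C x.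
  have UP : (forall x, U x -> P x) /\ independent U.
    split=> [x [[C [CP iC]] _ /= Cx]|s f us sU e]; first exact: CP.
    have [->//|[C [AC sC]]] : s = [::] \/ exists C, A C /\ forall x, x \in s ->
      sval C x.
      elim: s {us e} sU => [|y s IH] sU; [by left|right].
      have [C AC Cy] := sU y (mem_head _ _).
      have [x xs|->|[D [AD sD]]] := IH.
      - by apply: sU; rewrite inE xs orbT.
      - by exists C; split=> // x; rewrite inE => /eqP ->.
      - have [/boolp.asboolP CD|/boolp.asboolP DC] := tot _ _ AC AD.
          by exists D; split=> // x; rewrite inE => /orP [/eqP ->|]; [apply:
            CD|apply: sD].
        by exists C; split=> // x; rewrite inE => /orP [/eqP ->//|/sD]; apply: DC.
    by have [_ iC] := svalP C; apply: (iC s f).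
  by exists (exist _ U UP) => C AC; apply/boolp.asboolP => x Cx; exists C.
(* If v had no coordinates over B, adjoining v would preserve independence, and maximality would put
   v into B. *)
exists B; split=> // v Pv; apply: boolp.contrapT => nc.
have nBv : ~ B v.
  move=> Bv; apply: nc; exists (fun x => (x == v)%:R); exists [:: v]; split=> //.
  - by move=> x; rewrite inE => /eqP ->.
  - by move=> x; rewrite inE => /negPf ->.
  - by rewrite big_seq1 eqxx scale1r.
apply: nBv; pose C x := B x \/ x = v.
have iC : independent C.
  move=> s f us sC e.
  have sB x : x \in rem v s -> B x.
    by rewrite mem_rem_uniq // inE => /andP [/eqP nxv /sC []].
  have [vs|vs] := boolP (v \in s); last first.
    by apply: (iB s f us _ e) => x; rewrite -(rem_id vs); apply: sB.
  move: e; rewrite (perm_big _ (perm_to_rem vs)) big_cons /= => e.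
  have [fv0|fv0] := eqVneq (f v) 0.
    rewrite fv0 scale0r add0r in e; move=> x xs.
    have [->//|nxv] := eqVneq x v.
    by apply: (iB _ f (rem_uniq v us) sB e); rewrite mem_rem_uniq // inE nxv.
  exfalso; apply: nc.
  (* A relation with nonzero coefficient at v, solved for v. *)
  pose c x := if x \in rem v s then - (f v)^-1 * f x else 0.
  exists c, (rem v s); split=> //; first exact: rem_uniq.
    by move=> x /negPf h; rewrite /c h.
  apply: (scalerI fv0); move/eqP: e; rewrite addr_eq0 => /eqP ->.
  rewrite scaler_sumr -sumrN; apply: eq_big_seq => x xs.
  by rewrite /c xs scalerA mulrA mulrN divff // mulN1r scaleNr.
have CP : (forall x, C x -> P x) /\ independent C by split=> // x [/BP|->].
have := maxB (exist _ C CP) _; rewrite boolp.asboolE /= => /(_ (fun x h =>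
  or_introl h)).
by move=> /(congr1 sval) /= <-; right.
Qed.

(** J is a maximal independent subset of P. Coordinates are chosen only for vectors of P, hence the
    restrictions to P. *)
Lemma subspace_coordinates : exists (J : Type) (c : L -> J -> K),
  [/\ forall u v j, P u -> P v -> c (u + v) j = c u j + c v j,
      forall a v j, P v -> c (a *: v) j = a * c v j,
      forall v, P v -> (forall j, c v j = 0) -> v = 0,
      forall v, P v -> exists s : seq J, forall j, ~ List.In j s -> c v j = 0 &
      forall (f : J -> K) (s : seq J), (forall j, ~ List.In j s -> f j = 0) ->
        exists2 v, P v & forall j, c v j = f j].
Proof.
have [B [BP iB sp]] := maximal_independent.
have [c cP] : {c : L -> L -> K & forall v, P v -> coords B v (c v)}.
  apply: (boolp.choice (P := fun v c => P v -> coords B v c)) => v.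
  have [Pv|nPv] := boolp.pselect (P v); last by exists (fun=> 0) => /nPv.
  by have [c] := sp v Pv; exists c.
exists {x | B x}, (fun v j => c v (sval j)); split.
- move=> u v j Pu Pv; have uv := coordsD (cP _ Pu) (cP _ Pv).
  exact: (coords_inj iB (cP _ (PD Pu Pv)) uv).
- move=> a v j Pv; exact: (coords_inj iB (cP _ (PZ a Pv)) (coordsZ a (cP _ Pv))).
- move=> v Pv v0; have [s [us sB _ ->]] := cP v Pv.
  by apply: big1_seq => x /= /sB Bx; rewrite (v0 (exist _ x Bx)) scale0r.
- move=> v Pv; have [s [us sB c0 _]] := cP v Pv.
  have [t tP] : exists t : seq {x | B x}, forall j, sval j \in s -> List.In j t.
    elim: s {us c0} sB => [|x s IH] sB; first by exists [::].
    have [|t tP] := IH; first by move=> y ys; apply: sB; rewrite inE ys orbT.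
    exists (exist _ x (sB x (mem_head _ _)) :: t) => -[y By] /=.
    rewrite inE => /orP [/eqP e|ys]; last by right; apply: (tP (exist _ y By)).
    by left; subst y; congr exist; apply: boolp.Prop_irrelevance.
  by exists t => j nj; apply: c0; apply/negP => /tP.
- move=> f s f0.
  (* The family f on the basis is extended by 0 to all of L. *)
  pose d x := if boolp.pselect (B x) is left h then f (exist _ x h) else 0.
  have dE j : d (sval j) = f j.
    rewrite /d; case: boolp.pselect => [h|/(_ (svalP j)) //].
    by case: j h => x Bx h /=; congr f; congr exist; apply: boolp.Prop_irrelevance.
  pose t := undup (map sval s).
  have tB x : x \in t -> B x.
    rewrite mem_undup; elim: s {f0} @t => //= y s IH.
    by rewrite inE => /orP [/eqP ->|/IH //]; exact: svalP.
  have PS (r : seq L) : (forall x, x \in r -> B x) -> P (\sum_(x <- r) d x *: x).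
    elim: r => [|x r IH] rB; first by rewrite big_nil.
    rewrite big_cons; apply: PD; first by apply/PZ/BP/rB/mem_head.
    by apply: IH => y yr; apply: rB; rewrite inE yr orbT.
  exists (\sum_(x <- t) d x *: x); first exact: PS.
  move=> j; rewrite -dE; apply: (coords_inj (d := d) iB (cP _ (PS _ tB))).
  exists t; split=> //; first exact: undup_uniq.
  move=> x xt; rewrite /d; case: boolp.pselect => // Bx; apply: f0 => js.
  move/negP: xt; apply; rewrite mem_undup.
  elim: s js {t tB} => //= y s IH [->|/IH xs]; first exact: mem_head.
  by rewrite inE xs orbT.
Qed.
End Basis.

(** * The ring of additive endomorphisms *)

Section Endo.
Context (V : zmodType).

Record endo := Endo {
  endo_fun :> V -> V;
  endoD : {morph endo_fun : x y / x + y} }.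

Lemma endo_ext (f g : endo) : f =1 g -> f = g.
Proof.
case: f g => [f fD] [g gD] /= /boolp.funext fg; subst g; congr Endo.
exact: boolp.Prop_irrelevance.
Qed.

Lemma endo0 (f : endo) : f 0 = 0.
Proof. by apply: (addrI (f 0)); rewrite -endoD !addr0. Qed.

HB.instance Definition _ := boolp.gen_eqMixin endo.
HB.instance Definition _ := boolp.gen_choiceMixin endo.

Fact zero_endo_subproof : {morph (fun _ : V => 0 : V) : x y / x + y}.
Proof. by move=> x y; rewrite addr0. Qed.
Fact opp_endo_subproof (f : endo) : {morph (fun x => - f x) : x y / x + y}.
Proof. by move=> x y; rewrite endoD opprD. Qed.
Fact add_endo_subproof (f g : endo) : {morph (fun x => f x + g x) : x y / x + y}.
Proof. by move=> x y; rewrite !endoD addrACA. Qed.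
Fact one_endo_subproof : {morph (fun x : V => x) : x y / x + y}.
Proof. by []. Qed.
Fact mul_endo_subproof (f g : endo) : {morph (fun x => f (g x)) : x y / x + y}.
Proof. by move=> x y; rewrite !endoD. Qed.

Definition zero_endo := Endo zero_endo_subproof.
Definition opp_endo f := Endo (opp_endo_subproof f).
Definition add_endo f g := Endo (add_endo_subproof f g).
Definition one_endo := Endo one_endo_subproof.
Definition mul_endo f g := Endo (mul_endo_subproof f g).

Fact add_endoA : associative add_endo.
Proof. by move=> f g h; apply: endo_ext => x /=; rewrite addrA. Qed.
Fact add_endoC : commutative add_endo.
Proof. by move=> f g; apply: endo_ext => x /=; rewrite addrC. Qed.
Fact add_endo0 : left_id zero_endo add_endo.
Proof. by move=> f; apply: endo_ext => x /=; rewrite add0r. Qed.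
Fact add_endoN : left_inverse zero_endo opp_endo add_endo.
Proof. by move=> f; apply: endo_ext => x /=; rewrite addNr. Qed.

HB.instance Definition _ :=
  GRing.isZmodule.Build endo add_endoA add_endoC add_endo0 add_endoN.

Fact mul_endoA : associative mul_endo.
Proof. by move=> f g h; apply: endo_ext. Qed.
Fact mul_endo1 : left_id one_endo mul_endo.
Proof. by move=> f; apply: endo_ext. Qed.
Fact mul_1endo : right_id one_endo mul_endo.
Proof. by move=> f; apply: endo_ext. Qed.
Fact mul_endoDl : left_distributive mul_endo +%R.
Proof. by move=> f g h; apply: endo_ext. Qed.
Fact mul_endoDr : right_distributive mul_endo +%R.
Proof. by move=> f g h; apply: endo_ext => x /=; rewrite endoD. Qed.

(** V may be zero, and then 1 = 0; hence a ring structure without the nontriviality axiom. *)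
HB.instance Definition _ := GRing.Zmodule_isPzRing.Build endo
  mul_endoA mul_endo1 mul_1endo mul_endoDl mul_endoDr.

Lemma add_endoE (f g : endo) v : (f + g) v = f v + g v. Proof. by []. Qed.
Lemma mul_endoE (f g : endo) v : (f * g) v = f (g v). Proof. by []. Qed.

Lemma sum_endoE (I : Type) (r : seq I) (P : pred I) (F : I -> endo) v :
  (\sum_(i <- r | P i) F i) v = \sum_(i <- r | P i) F i v.
Proof. by apply: (big_morph (fun f : endo => f v)). Qed.

Lemma mulrn_endoE (f : endo) n v : (f *+ n) v = f v *+ n.
Proof. by elim: n => //= n IH; rewrite !mulrS add_endoE IH. Qed.

Lemma endo_sum (f : endo) (I : Type) (r : seq I) (P : pred I) (F : I -> V) :
  f (\sum_(i <- r | P i) F i) = \sum_(i <- r | P i) f (F i).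
Proof. by apply: big_morph; [exact: endoD|exact: endo0]. Qed.

(** The default value 0 makes this total, so that [act] yields an endomorphism even at matrices of
    determinant other than 1. *)
Definition to_endo (f : V -> V) : endo :=
  if boolp.pselect {morph f : x y / x + y} is left fD then Endo fD else 0.

Lemma to_endoE f : {morph f : x y / x + y} -> to_endo f =1 f.
Proof. by rewrite /to_endo; case: boolp.pselect. Qed.
End Endo.

(** * Matrix units and matrices over their centralizer *)

Section MatrixUnits.
Context (R : pzRingType) (n : nat) (E : 'I_n -> 'I_n -> R).
Context (EM : forall i j k l, E i j * E k l = E i l *+ (j == k)).
Context (E1 : \sum_k E k k = 1).

(* The matrix of r under R = M_n(C), with C the centralizer of the matrix
   units E. *)
Definition unit_mx (r : R) : 'M[R]_n :=
  \matrix_(j, k) \sum_i E i j * r * E k i.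

(** Insert 1, as the sum of the E k k, between r and s. *)
Lemma unit_mxM r s : unit_mx (r * s) = unit_mx r *m unit_mx s.
Proof.
apply/matrixP => j l; rewrite !mxE.
under [RHS]eq_bigr => k _.
  rewrite !mxE big_distrl /=.
  under eq_bigr => i _.
    rewrite big_distrr (bigD1 i) //= big1 => [|i' ni]; last first.
      by rewrite !mulrA -(mulrA _ (E k i)) EM eq_sym (negPf ni) mulr0 !mul0r.
    rewrite addr0 !mulrA -(mulrA _ (E k i)) EM eqxx mulr1n.
    over.
  over.
rewrite exchange_big; apply: eq_bigr => i _ /=.
by rewrite -!big_distrl -big_distrr /= E1 mulr1 !mulrA.
Qed.

Lemma unit_mx1 : unit_mx 1 = 1%:M.
Proof.
apply/matrixP => j k; rewrite !mxE.
under eq_bigr => i _ do rewrite mulr1 EM.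
by rewrite sumrMnl E1.
Qed.

(** With [mulE_unit_mx] this shows that the entries of [unit_mx r] commute with all matrix units,
    that is, lie in C. *)
Lemma unit_mx_mulE r a b j k : unit_mx r a b * E j k = E j a * r * E b k.
Proof.
rewrite mxE big_distrl (bigD1 j) //= big1 => [|i ni].
  by rewrite addr0 -mulrA EM eqxx.
by rewrite -mulrA EM (negPf ni) mulr0.
Qed.

Lemma mulE_unit_mx r a b j k : E j k * unit_mx r a b = E j a * r * E b k.
Proof.
rewrite mxE big_distrr (bigD1 k) //= big1 => [|i ni].
  by rewrite addr0 !mulrA EM eqxx.
by rewrite !mulrA EM eq_sym (negPf ni) !mul0r.
Qed.

Lemma unit_mxK r i j : E i j * r = \sum_k unit_mx r j k * E i k.
Proof.
under eq_bigr => k _ do rewrite unit_mx_mulE.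
by rewrite -big_distrr /= E1 mulr1.
Qed.
End MatrixUnits.

(** * Scalars from the prime subfield *)

Section PrimeField.
Context (K : fieldType).

Lemma prime_subfield_int (m : int) : in_prime_subfield (m%:~R : K).
Proof. by exists m, 1; rewrite oner_neq0 divr1. Qed.

Lemma prime_subfield0 : in_prime_subfield (0 : K).
Proof. exact: (prime_subfield_int 0). Qed.
Lemma prime_subfield1 : in_prime_subfield (1 : K).
Proof. exact: (prime_subfield_int 1). Qed.
Lemma prime_subfieldN1 : in_prime_subfield (- 1 : K).
Proof. exact: (prime_subfield_int (-1)). Qed.

Lemma prime_subfield_natV (m : nat) : in_prime_subfield (m%:R^-1 : K).
Proof.
have [m0|m0] := eqVneq (m%:R : K) 0; last by exists 1, m; rewrite mul1r pmulrn.
by rewrite m0 invr0; exact: prime_subfield0.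
Qed.

Lemma prime_subfield_nat (m : nat) : in_prime_subfield (m%:R : K).
Proof. by rewrite pmulrn; exact: prime_subfield_int. Qed.

Context (V : zmodType) (s : K -> V -> V).
Context (hs : is_vspace_over (@in_prime_subfield K) s).

Lemma vspace0 v : s 0 v = 0.
Proof.
have [_ sD _ _] := hs; have F0 := prime_subfield0.
by apply: (addrI (s 0 v)); rewrite -sD // !addr0.
Qed.

Lemma vspace_nat m v : s m%:R v = v *+ m.
Proof.
have [_ sD _ s1] := hs; elim: m => [|m IH]; first exact: vspace0.
rewrite -natr1 sD ?IH ?s1 ?mulrSr //; first exact: prime_subfield_nat.
exact: prime_subfield1.
Qed.

Lemma vspace_int (m : int) v : s m%:~R v = v *~ m.
Proof.
have [_ sD _ _] := hs; case: m => m; first exact: vspace_nat.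
apply: (addIr (s m.+1%:R v)); rewrite -sD; last 2 first.
- exact: prime_subfield_int.
- exact: prime_subfield_nat.
by rewrite NegzE mulrNz addNr vspace0 vspace_nat mulrNz addNr.
Qed.

(** As 1/m lies in the prime subfield, scaling by it undoes multiplication by m. *)
Lemma vspace_torsion (m : nat) (v : V) : m%:R != 0 :> K -> v *+ m = 0 -> v = 0.
Proof.
have [sDr _ sM s1] := hs; move=> m0 e.
have F := prime_subfield_natV m.
rewrite -[v]s1 -(mulVf m0) sM //; last exact: prime_subfield_nat.
rewrite vspace_nat e; apply: (addrI (s m%:R^-1 0)).
by rewrite -sDr // !addr0.
Qed.

Lemma vspace_torsionz (m : int) (v : V) : m%:~R != 0 :> K -> v *~ m = 0 -> v = 0.
Proof.
case: m => m; first exact: vspace_torsion.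
rewrite NegzE !mulrNz oppr_eq0 => m0 /eqP; rewrite oppr_eq0 => /eqP.
exact: vspace_torsion.
Qed.

Lemma vspace_frac (a b : int) v : b%:~R != 0 :> K ->
  s (a%:~R / b%:~R) v *~ b = v *~ a.
Proof.
move=> b0; have [_ _ sM _] := hs.
rewrite -!vspace_int -sM; [|exact: prime_subfield_int|by exists a, b].
by rewrite mulrC divfK.
Qed.
End PrimeField.

(** * Finite supports, and vector spaces as modules *)

Lemma fin_support (n : nat) (J : Type) (Q : 'I_n -> J -> Prop) :
  (forall k, exists s : seq J, forall j, ~ List.In j s -> Q k j) ->
  exists s : seq J, forall j, ~ List.In j s -> forall k, Q k j.
Proof.
move=> H.
suff [s sP] : exists s : seq J, forall j, ~ List.In j s ->
    forall k, k \in enum 'I_n -> Q k j.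
  by exists s => j /sP h k; apply: h; rewrite mem_enum.
elim: (enum _) => [|k r [s sP]]; first by exists [::].
have [t tP] := H k; exists (t ++ s) => j nj l; rewrite inE => /orP [/eqP ->|lr].
  by apply: tP => jt; apply/nj/List.in_or_app; left.
by apply: sP lr => js; apply/nj/List.in_or_app; right.
Qed.

Section VspaceLmod.
Context (K : fieldType) (V : zmodType) (s : K -> V -> V).

(** A copy of V indexed by the proof of the axioms, so that the module structure is attached to the
    copy and not to V. *)
Definition vspace_lmod of is_vspace_over (fun _ => True) s : Type := V.

Context (hs : is_vspace_over (fun _ => True) s).
Local Notation L := (vspace_lmod hs).

HB.instance Definition _ := GRing.Zmodule.copy L V.

Fact vspace_scaleA (a b : K) (v : L) : s a (s b v) = s (a * b) v.
Proof. by have [_ _ sM _] := hs; rewrite sM. Qed.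
Fact vspace_scale1 : left_id 1 (s : K -> L -> L).
Proof. by have [] := hs. Qed.
Fact vspace_scaleDr : right_distributive (s : K -> L -> L) +%R.
Proof. by have [sD _ _ _] := hs => a u v; apply: sD. Qed.
Fact vspace_scaleDl (v : L) : {morph s^~ v : a b / a + b}.
Proof. by have [_ sD _ _] := hs => a b; apply: sD. Qed.

HB.instance Definition _ := GRing.Zmodule_isLmodule.Build K L
  vspace_scaleA vspace_scale1 vspace_scaleDr vspace_scaleDl.
End VspaceLmod.

(** * The K-structure on V and its decomposition *)

Section Assembly.
Context (K : fieldType) (N : nat) (V : zmodType) (act : 'M[K]_2 -> V -> V).
Context (scal1 : K -> V -> V) (I : Type) (phi : V -> I -> {mpoly K[2]}).
Local Notation F := (@in_prime_subfield K).
Local Notation d := N.+1.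
Context (charK : forall p : nat, p \in [pchar K] -> (2 * N.+2 + 1 <= p)%N).
Context (sqK : forall a : K, exists b, b * b = a).
Context (actV : is_SL2_module act) (vs1 : is_vspace_over F scal1).
Context (phiD : forall u v i, phi (u + v) i = phi u i + phi v i).
Context (phiG : forall g v i, SL2 F g -> phi (act g v) i = sym_act g (phi v i)).
Context (phi_inj : injective phi).
Context (phi_in : forall v, in_dsum_Sym F N.+2 (phi v)).
Context (phi_surj : forall f, in_dsum_Sym F N.+2 f -> exists v, phi v = f).

Definition coef v i (k : 'I_N.+2) : K := (phi v i)@_(mon d k).

Lemma coefD u v i k : coef (u + v) i k = coef u i k + coef v i k.
Proof. by rewrite /coef phiD raddfD. Qed.

Lemma coef0 i k : coef 0 i k = 0.
Proof. by apply: (addrI (coef 0 i k)); rewrite -coefD !addr0. Qed.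

Lemma coef_sum (T : Type) (r : seq T) (P : pred T) (G : T -> V) i k :
  coef (\sum_(x <- r | P x) G x) i k = \sum_(x <- r | P x) coef (G x) i k.
Proof.
by apply: (big_morph (fun v => coef v i k)) => [u v|]; [exact: coefD|exact: coef0].
Qed.

Lemma coefMn v m i k : coef (v *+ m) i k = coef v i k *+ m.
Proof. by elim: m => [|m IH]; rewrite ?mulr0n ?coef0 // !mulrS coefD IH. Qed.

Lemma coefN v i k : coef (- v) i k = - coef v i k.
Proof. by apply: (addrI (coef v i k)); rewrite -coefD !subrr coef0. Qed.

Lemma phi_coef v i : phi v i = \sum_k coef v i k *: 'X_[mon d k].
Proof. by apply: homog_mon; have [_ /(_ i) []] := phi_in v. Qed.

Lemma coef_ext u v : (forall i k, coef u i k = coef v i k) -> u = v.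
Proof.
move=> e; apply: phi_inj; apply: boolp.funext => i.
by rewrite !phi_coef; apply: eq_bigr => k _; rewrite e.
Qed.

(** By surjectivity of [phi]: moving the coefficient at k to the monomial j keeps supports finite
    and coefficients in the prime subfield. *)
Lemma matrix_unit_exists j k v : exists v' : V,
  forall i l, coef v' i l = coef v i k *+ (l == j).
Proof.
pose f i : {mpoly K[2]} := \sum_l (coef v i k *+ (l == j)) *: 'X_[mon d l].
have [v' v'E] : exists v', phi v' = f; last first.
  by exists v' => i l; rewrite /coef v'E coef_sum_mon.
apply: phi_surj; have [[s sP] hP] := phi_in v; split.
  exists s => i /sP e; rewrite /f big1 // => l _.
  by rewrite /coef e mcoeff0 mul0rn scale0r.
move=> i; split; first exact: sum_mon_homog.
move=> m; have [e|ne] := eqVneq (mdeg m) d; last first.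
  by rewrite coef_sum_mon_neq //; exact: prime_subfield0.
have lt : leq (m 1).+1 d.+1 by rewrite ltnS -e mdeg2 leq_addl.
rewrite [m]mon_mdeg e -[m 1]/(nat_of_ord (Ordinal lt)) coef_sum_mon.
case: (_ == j); first by have [_] := hP i; apply.
exact: prime_subfield0.
Qed.

Definition munit_fun j k v := sval (boolp.cid (matrix_unit_exists j k v)).

Lemma munit_funE j k v i l : coef (munit_fun j k v) i l = coef v i k *+ (l == j).
Proof. exact: (svalP (boolp.cid (matrix_unit_exists j k v))). Qed.

Definition munit j k : endo V := to_endo (munit_fun j k).

Lemma coef_munit j k v i l : coef (munit j k v) i l = coef v i k *+ (l == j).
Proof.
rewrite /munit to_endoE ?munit_funE // => x y; apply: coef_ext => i' l'.
by rewrite coefD !munit_funE coefD mulrnDl.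
Qed.

Lemma munitM i j k l : munit i j * munit k l = munit i l *+ (j == k).
Proof.
apply: endo_ext => v; apply: coef_ext => x y.
rewrite mulrn_endoE coefMn !coef_munit -!mulrnA.
by case: (j == k) (y == i) => [] []; rewrite ?muln1 ?muln0 ?mul1n.
Qed.

Lemma munit1 : \sum_k munit k k = 1.
Proof.
apply: endo_ext => v; apply: coef_ext => x y; rewrite sum_endoE coef_sum.
rewrite (bigD1 y) //= big1 => [|k nk]; first by rewrite coef_munit eqxx addr0.
by rewrite coef_munit eq_sym (negPf nk).
Qed.

Definition act_endo g : endo V := to_endo (act g).

Lemma act_endoE g v : \det g = 1 -> act_endo g v = act g v.
Proof.
move=> g1; rewrite /act_endo to_endoE // => x y.
by have [h _ _] := actV; apply: h; split.
Qed.

Lemma act_endoM g h : \det g = 1 -> \det h = 1 ->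
  act_endo (g *m h) = act_endo g * act_endo h.
Proof.
move=> g1 h1; apply: endo_ext => v.
rewrite mul_endoE !act_endoE ?det_mulmx ?g1 ?h1 ?mulr1 //.
by have [_ _ ->] := actV; split.
Qed.

Lemma act_endo1 : act_endo 1%:M = 1.
Proof.
apply: endo_ext => v; rewrite act_endoE ?det1 //.
by have [_ -> _] := actV.
Qed.

Definition act_mx g : 'M[endo V]_N.+2 := unit_mx munit (act_endo g).

Lemma act_mxM g h : \det g = 1 -> \det h = 1 ->
  act_mx (g *m h) = act_mx g *m act_mx h.
Proof.
by move=> g1 h1; rewrite /act_mx act_endoM // (unit_mxM munitM munit1).
Qed.

(** On points over the prime subfield [phi] is equivariant, so the entries are those of Sym^(n-1),
    acting on coordinates by multiplication. *)
Lemma coef_act_mx g j k v i l : SL2 F g ->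
  coef (act_mx g j k v) i l = (sym_act g 'X_[mon d k])@_(mon d j) * coef v i l.
Proof.
move=> Fg; rewrite /act_mx mxE sum_endoE coef_sum (bigD1 l) //= big1 ?addr0;
  last first.
  by move=> x nx; rewrite coef_munit eq_sym (negPf nx).
rewrite coef_munit eqxx mulr1n act_endoE; last by case: Fg.
rewrite {1}/coef phiG // phi_coef sym_act_sum raddf_sum (bigD1 k) //= big1 ?addr0.
  by rewrite sym_actZ mcoeffZ coef_munit eqxx mulrC.
by move=> x nx; rewrite sym_actZ mcoeffZ coef_munit (negPf nx) mul0r.
Qed.

Lemma SL2_mx2 (a b c e : K) : F a -> F b -> F c -> F e -> a * e - b * c = 1 ->
  SL2 F (mx2 a b c e).
Proof.
move=> ? ? ? ? det1; split; first by rewrite det_mx2.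
by move=> i j; rewrite mxE; case: ifP => _; case: ifP.
Qed.


Lemma act_mx_umx1 j k : act_mx (umx 1) j k = 'C(k, j)%:R.
Proof.
apply: endo_ext => v; apply: coef_ext => i l; rewrite coef_act_mx; last first.
  apply: SL2_mx2; last (by ring); try exact: prime_subfield1.
  exact: prime_subfield0.
rewrite sym_act_umx coef_sum_mon expr1n mulrn_endoE coefMn.
by rewrite mulr_natl.
Qed.

Lemma act_mx_wmx j k : act_mx (wmx K) j k = if (j + k == N.+1)%N then (-1) ^+ j
  else 0.
Proof.
apply: endo_ext => v; apply: coef_ext => i l; rewrite coef_act_mx; last first.
  apply: SL2_mx2; last (by ring); try exact: prime_subfield0.
    exact: prime_subfield1.
  exact: prime_subfieldN1.
rewrite sym_act_wmx mcoeffZ mcoeffX mon_inj /=.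
have [jk|njk] := eqVneq (j + k)%N N.+1; last first.
  rewrite (_ : (_ == _) = false) ?mulr0 ?mul0r ?coef0 //.
  by have := ltn_ord k; lia.
rewrite (_ : (_ == _) = true) ?mulr1; last by lia.
rewrite (_ : (d - k)%N = j); last by lia.
rewrite -signr_odd -[(-1) ^+ j in RHS]signr_odd; case: odd;
  rewrite ?expr0 ?mul1r // expr1 mulN1r.
by rewrite -coefN.
Qed.

Lemma act_mx_tmx (a : nat) j k : a%:R != 0 :> K ->
  act_mx (tmx a%:R) j k *+ a ^ d = (a ^ (2 * (d - k)))%:R *+ (j == k).
Proof.
move=> a0; apply: endo_ext => v; apply: coef_ext => i l.
rewrite !mulrn_endoE !coefMn coef_act_mx; last first.
  apply: SL2_mx2; rewrite ?mulr0 ?subr0 ?divff //; try exact: prime_subfield0.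
    exact: prime_subfield_nat.
  exact: prime_subfield_natV.
rewrite sym_act_tmx mcoeffZ mcoeffX mon_inj eq_sym.
have [<-|njk] := eqVneq j k; last by rewrite (inj_eq val_inj) (negPf njk) mulr0
  mul0r mul0rn mulr0n.
rewrite eqxx mulr1 mulr1n -[LHS]mulr_natl -[RHS]mulr_natl !natrX mulrA;
  congr (_ * _).
have ad : a%:R ^+ d = a%:R ^+ (d - j) * a%:R ^+ j :> K.
  by rewrite -exprD subnK ?leq_ord.
have aj : a%:R ^+ j * a%:R^-1 ^+ j = 1 :> K by rewrite -exprMn divff ?expr1n.
by rewrite ad mulrACA aj mulr1 -exprD addnn mul2n.
Qed.

Lemma small_natr_neq0 m : (0 < m <= N.+1.*2.+1)%N -> m%:R != 0 :> K.
Proof.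
case/andP=> m0 mN; apply/negP => mK0.
have [p pK] := natf0_pchar m0 mK0.
have pm : (p <= m)%N by apply: dvdn_leq => //; rewrite (dvdn_pcharf pK).
by have := charK pK; lia.
Qed.

Lemma endo_torsion m (r : endo V) : m%:R != 0 :> K -> r *+ m = 0 -> r = 0.
Proof.
move=> m0 e; apply: endo_ext => v; apply: (vspace_torsion vs1 m0).
by rewrite -mulrn_endoE e.
Qed.

(** The map [alpha] for the unipotents of G, with values in [endo V]. *)
Definition scalar b : endo V := act_mx (umx b) 0 1.

Lemma scalar_morphism : [/\ scalar 1 = 1,
  (forall a b, scalar (a + b) = scalar a + scalar b),
  (forall a b, scalar (a * b) = scalar a * scalar b) &
  (forall b j k, act_mx (umx b) j k = scalar b ^+ (k - j) *+ 'C(k, j))].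
Proof.
apply: (@unipotent_morphism K (endo V) N small_natr_neq0 endo_torsion sqK
  (fun b => act_mx (umx b)) (fun a => act_mx (tmx a)) (act_mx (wmx K))).
(* What remains are relations between u, t and w, checked on 2 x 2 matrices, and the known matrices
   over the prime subfield. *)
- by rewrite /act_mx /umx mx2_1 act_endo1 (unit_mx1 munitM munit1).
- move=> a b; rewrite -act_mxM ?det_umx // mulmx2;
  congr (act_mx (mx2 _ _ _ _)); ring.
- move=> a b a0 b0; rewrite -act_mxM ?det_tmx // mulmx2.
  by congr (act_mx (mx2 _ _ _ _)); field; rewrite ?a0 ?b0.
- by rewrite /act_mx /tmx invr1 mx2_1 act_endo1 (unit_mx1 munitM munit1).
- move=> a b a0; rewrite -!act_mxM ?det_tmx ?det_umx // !mulmx2.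
  by congr (act_mx (mx2 _ _ _ _)); field.
- move=> a a0; rewrite -!act_mxM ?det_mulmx ?det_tmx ?det_umx ?det_wmx ?mulr1 //.
  by rewrite !mulmx2; congr (act_mx (mx2 _ _ _ _)); field.
- exact: act_mx_umx1.
- exact: act_mx_wmx.
- exact: act_mx_tmx.
Qed.

Lemma scalarD a b : scalar (a + b) = scalar a + scalar b.
Proof. by have [] := scalar_morphism. Qed.
Lemma scalarM a b : scalar (a * b) = scalar a * scalar b.
Proof. by have [] := scalar_morphism. Qed.
Lemma scalar1 : scalar 1 = 1. Proof. by have [] := scalar_morphism. Qed.
Lemma scalar0 : scalar 0 = 0.
Proof. by apply: (addrI (scalar 0)); rewrite -scalarD !addr0. Qed.
Lemma scalarN a : scalar (- a) = - scalar a.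
Proof. by apply: (addrI (scalar a)); rewrite -scalarD !subrr scalar0. Qed.
Lemma scalarMn a m : scalar (a *+ m) = scalar a *+ m.
Proof. by elim: m => [|m IH]; rewrite ?scalar0 // !mulrS scalarD IH. Qed.
Lemma scalarX a m : scalar (a ^+ m) = scalar a ^+ m.
Proof. by elim: m => [|m IH]; rewrite ?scalar1 // !exprS scalarM IH. Qed.

Lemma scalar_munit a j k v : scalar a (munit j k v) = munit j k (scalar a v).
Proof.
by rewrite -!mul_endoE /scalar /act_mx (unit_mx_mulE munitM) (mulE_unit_mx munitM).
Qed.

Lemma act_mx_umx b j k : act_mx (umx b) j k = scalar (b ^+ (k - j) *+ 'C(k, j)).
Proof. by have [_ _ _ ->] := scalar_morphism; rewrite scalarMn scalarX. Qed.

Lemma act_mx_wmx_scalar j k :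
  act_mx (wmx K) j k = scalar ((-1) ^+ j *+ (j + k == N.+1)%N).
Proof. by rewrite act_mx_wmx; case: ifP; rewrite ?mulr0n ?scalar0 // scalarX
  scalarN scalar1. Qed.

(** Only j = d - k contributes, which turns the sign (-1)^(d - k) into the (-1)^j of
    [act_mx_wmx_scalar]. *)
Lemma sym_act_wmx_sum (k : 'I_N.+2) : sym_act (wmx K) 'X_[mon d k] =
  \sum_(j < N.+2) ((-1) ^+ j *+ (j + k == N.+1)%N) *: 'X_[mon d j].
Proof.
have e : rev_ord k = (d - k)%N :> nat by rewrite /= subSS.
rewrite sym_act_wmx (bigD1 (rev_ord k)) //= big1 ?addr0 => [|j].
  by rewrite subSS subnK ?leq_ord // eqxx.
rewrite -val_eqE /= => nj; rewrite (_ : _ == _ = false) ?scale0r //.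
by have := ltn_ord k; lia.
Qed.

Definition scal a v := scalar a v.

Lemma scal_vspace : is_vspace_over (fun _ => True) scal.
Proof.
split=> [a u v _|a b v _ _|a b v _ _|v].
- exact: endoD.
- by rewrite /scal scalarD.
- by rewrite /scal scalarM.
- by rewrite /scal scalar1.
Qed.

(** For a = p/q both sides give p v when multiplied by q, and V has no q-torsion. *)
Lemma scal_prime a v : F a -> scal a v = scal1 a v.
Proof.
move=> [p [q [q0 ->]]]; apply/eqP; rewrite -subr_eq0; apply/eqP.
apply: (vspace_torsionz vs1 q0); rewrite mulrzBl (vspace_frac vs1) //.
rewrite (@vspace_frac _ _ scal) ?subrr //.
by have [sDr sD sM s1] := scal_vspace; split=> *; auto.
Qed.

(** E_00 V is a K-subspace because scalars commute with the matrix units. Composing its coordinates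
    with the projection E_00 extends them to V. *)
Lemma coordinates : exists (J : Type) (c : V -> J -> K),
  [/\ forall u v j, c (u + v) j = c u j + c v j,
      forall a v j, c (scal a v) j = a * c v j,
      forall v, munit 0 0 v = v -> (forall j, c v j = 0) -> v = 0,
      forall v, exists s : seq J, forall j, ~ List.In j s -> c v j = 0 &
      forall (f : J -> K) (s : seq J), (forall j, ~ List.In j s -> f j = 0) ->
        exists2 v, munit 0 0 v = v & forall j, c v j = f j].
Proof.
pose e v := munit 0 0 (v : V).
have eD u v : e (u + v) = e u + e v by exact: endoD.
have eZ a v : e (scal a v) = scal a (e v) by rewrite /e /scal scalar_munit.
have ee v : e (e v) = e v by rewrite /e -mul_endoE munitM.
have [|||J [c [cD cZ c0 cs c_onto]]] :=
  @subspace_coordinates K (vspace_lmod scal_vspace) (fun v : V => e v = v).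
- exact: endo0.
- by move=> u v eu ev; rewrite eD eu ev.
- by move=> a v ev; rewrite eZ ev.
exists J, (fun v j => c (e v) j); split.
- by move=> u v j; rewrite eD cD.
- by move=> a v j; rewrite eZ cZ.
- by move=> v ev h; apply: c0 => // j; rewrite -(h j) /e ev.
- by move=> v; apply: cs.
- move=> h s hs; have [v ev cv] := c_onto h s hs.
  by exists v => // j; rewrite ev.
Qed.

Lemma scal_iso : iso_dsum_Sym (fun _ => True) N.+2 act scal.
Proof.
have [J [c [cD cZ c0 cs c_onto]]] := coordinates.
have c00 j : c 0 j = 0 by apply: (addrI (c 0 j)); rewrite -cD !addr0.
have c_sum (T : Type) (r : seq T) (P : pred T) (G : T -> V) j :
    c (\sum_(x <- r | P x) G x) j = \sum_(x <- r | P x) c (G x) j.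
  by apply: (big_morph (fun v => c v j)) => [u v|]; [exact: cD|exact: c00].
(* E_0k carries the k-th component of v into E_00 V, whose j-th coordinate becomes the coefficient
   of the k-th monomial in copy j. *)
pose psi v j : {mpoly K[2]} := \sum_k c (munit 0 k v) j *: 'X_[mon d k].
(* Equivariance at g follows when g acts on V and on Sym^(n-1) by the same matrix over K. This is
   the case for u_b and w, which suffice by [SL2_gen]. *)
have psiG (S : 'I_N.+2 -> 'I_N.+2 -> K) g : \det g = 1 ->
    (forall k : 'I_N.+2, sym_act g 'X_[mon d k] = \sum_l S l k *: 'X_[mon d l]) ->
    (forall l k, act_mx g l k = scalar (S l k)) ->
    forall v j, psi (act g v) j = sym_act g (psi v j).
  move=> g1 gS rS v j; rewrite /psi sym_act_sum.
  under [RHS]eq_bigr => k _ do rewrite sym_actZ gS scaler_sumr.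
  rewrite exchange_big; apply: eq_bigr => l _.
  rewrite -act_endoE // -mul_endoE (unit_mxK munitM munit1) sum_endoE c_sum
    scaler_suml.
  apply: eq_bigr => k _; rewrite scalerA mulrC; congr (_ *: _).
  by rewrite -cZ /scal -rS.
exists J, psi; split.
- move=> u v j; rewrite -big_split; apply: eq_bigr => k _ /=.
  by rewrite endoD cD scalerDl.
- move=> a v j _; rewrite scaler_sumr; apply: eq_bigr => k _.
  by rewrite scalerA -cZ /scal scalar_munit.
- move=> g v j [g1 _]; move: g g1 v j; apply: SL2_gen => [g h g1 h1 Pg Ph v j|b|].
  + have [_ _ ->] := actV; [|by []|by []].
    by rewrite Pg Ph sym_actM.
  + apply: (psiG (fun j k : 'I_N.+2 => b ^+ (k - j) *+ 'C(k, j))).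
    * exact: det_umx.
    * by move=> k; rewrite sym_act_umx.
    * by move=> j k; rewrite act_mx_umx.
  + apply: (psiG (fun j k : 'I_N.+2 => (-1) ^+ j *+ (j + k == N.+1)%N)).
    * exact: det_wmx.
    * exact: sym_act_wmx_sum.
    * exact: act_mx_wmx_scalar.
- have psi_ker v : (forall j, psi v j = 0) -> v = 0.
    (* Here v is the sum of the E_k0 E_0k v, and each E_0k v vanishes with its coordinates. *)
    move=> h; rewrite -[v]/((1 : endo V) v) -munit1 sum_endoE big1 // => k _.
    suff e : munit 0 k v = 0.
      have := munitM k 0 0 k; rewrite eqxx mulr1n => <-.
      by rewrite mul_endoE e endo0.
    apply: c0 => [|j]; first by rewrite -mul_endoE munitM eqxx.
    by have := congr1 (fun p => p@_(mon d k)) (h j);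
      rewrite /= coef_sum_mon mcoeff0.
  move=> u v uv; apply/eqP; rewrite -subr_eq0; apply/eqP/psi_ker => j.
  have := congr1 (fun f => f j) uv; rewrite /psi => e.
  under eq_bigr => k _ do rewrite endoD cD scalerDl.
  rewrite big_split /= e -big_split big1 // => k _ /=.
  by rewrite -scalerDl -cD -endoD subrr endo0 c00 scale0r.
- split=> [v|f [[s sP] fP]].
    split; last by move=> j; split=> //; exact: sum_mon_homog.
    have [s sP] := fin_support (fun k => cs (munit 0 k v)).
    by exists s => j /sP h; rewrite /psi big1 // => k _; rewrite h scale0r.
  have /boolp.choice [b bP] : forall k : 'I_N.+2, exists v,
      munit 0 0 v = v /\ forall j, c v j = (f j)@_(mon d k).
    move=> k; have [j /sP ->|v ev cv] := c_onto (fun j => (f j)@_(mon d k)) s.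
      exact: mcoeff0.
    by exists v.
  (* The coordinates of b_k in E_00 V are the k-th coefficients of f, and E_k0 moves b_k to the k-th
     component. *)
  exists (\sum_k munit k 0 (b k)); apply: boolp.funext => j.
  rewrite [RHS](homog_mon (fP j).1); apply: eq_bigr => k _; congr (_ *: _).
  have [bk <-] := bP k; congr (c _ j).
  rewrite endo_sum (bigD1 k) //= big1 ?addr0 => [|l nl].
    by rewrite -mul_endoE munitM eqxx bk.
  by rewrite -mul_endoE munitM eq_sym (negPf nl).
Qed.
End Assembly.

(** * Square roots in K and conclusion *)

Lemma dfact_gt0 m : (0 < dfact m)%N.
Proof.
have [] : (0 < dfact m)%N /\ (0 < dfact m.+1)%N by elim: m => // m [h1 h2];
  split=> //=; rewrite muln_gt0.
by [].
Qed.

(** The polynomial X^(2m) - a splits and has positive degree, so it has a root x, and x^m is a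
    square root of a. *)
Lemma radically_closed_sqrt (K : fieldType) m : (0 < m)%N ->
  radically_closed K (2 * m) -> forall a : K, exists b, b * b = a.
Proof.
move=> m0 rad a; have [[|x s] e] := rad a.
  have := congr1 (fun p : {poly K} => size p) e.
  by rewrite /= big_nil size_polyC oner_neq0 size_XnsubC ?muln_gt0 //; lia.
exists (x ^+ m); have := congr1 (fun p => p.[x]) e.
rewrite big_cons /= hornerM !hornerE subrr mul0r => /eqP.
by rewrite subr_eq0 -exprD addnn -mul2n => /eqP.
Qed.

Theorem theorem2 (n : nat) (K : fieldType) (V : zmodType)
    (act : 'M[K]_2 -> V -> V) (scal1 : K -> V -> V) :
  (2 <= n)%N ->
  (forall p : nat, p \in [pchar K] -> (2 * n + 1 <= p)%N) ->
  radically_closed K (2 * dfact n.-1) ->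
  is_SL2_module act ->
  is_vspace_over (@in_prime_subfield K) scal1 ->
  iso_dsum_Sym (@in_prime_subfield K) n act scal1 ->
  exists scal : K -> V -> V,
    [/\ is_vspace_over (fun _ => True) scal,
        (forall a v, in_prime_subfield a -> scal a v = scal1 a v) &
        iso_dsum_Sym (fun _ => True) n act scal].
Proof.
case: n => [|[|N]] // _ charK /(radically_closed_sqrt (dfact_gt0 _)) sqK actV vs1.
move=> [I [phi [phiD _ phiG phi_inj [phi_in phi_surj]]]].
exists (scal act phi_in phi_surj); split.
- exact: (scal_vspace charK sqK actV vs1).
- exact: (scal_prime charK sqK actV vs1).
- exact: (scal_iso charK sqK actV vs1).
Qed.
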